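(* Let $n\in\mathbb N$ and let $R_n=\{p\in\beta S_0:\ \forall B\in p\ \exists w\in S_n \text{ with } \{w(\vec x):\vec x\in\mathbb A^n\}\subseteq B\}$. Then $R_n$ is a compact two-sided ideal of $\beta S_0$.
   Context: $\mathbb A$ is a fixed nonempty finite alphabet, $S_0=\mathbb A^+$ the free semigroup of nonempty words over $\mathbb A$ under concatenation, $v_1,\dots,v_n$ distinct variables not in $\mathbb A$, and $S_n$ the set of nonempty words over $\mathbb A\cup\{v_1,\dots,v_n\}$ in which every $v_i$ occurs. For $\vec x=(x_1,\dots,x_n)\in\mathbb A^n$, $w(\vec x)$ replaces each occurrence of $v_i$ in $w$ by $x_i$. $\beta S_0$ is the Stone–Čech compactification of the discrete semigroup $S_0$ (its ultrafilters), with the extended operation ($A\in pq$ iff $\{x:x^{-1}A\in q\}\in p$, $x^{-1}A=\{y:xy\in A\}$), making it a compact Hausdorff right topological semigroup. An ideal is a nonempty set $I$ with $\beta S_0\, I\cup I\,\beta S_0\subseteq I$. *)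

(* Defs.v *)
From HB Require Import structures.
From mathcomp Require Import all_boot.
From mathcomp Require Import all_classical.
From mathcomp Require Import topology.

Set Implicit Arguments.
Unset Strict Implicit.
Unset Printing Implicit Defensive.

Local Open Scope classical_set_scope.

(* [p A] reads "A belongs to the ultrafilter p". *)
Record beta (S : Type) := Beta {
  beta_sets :> set S -> Prop;
  beta_ultra : UltraFilter beta_sets }.

#[global] Existing Instance beta_ultra.

HB.instance Definition _ S := gen_eqMixin (beta S).
HB.instance Definition _ S := gen_choiceMixin (beta S).

Section BetaFacts.
Variable S : Type.
Implicit Types (p q : beta S) (A B : set S).

Lemma beta_ext p q : beta_sets p `<=` beta_sets q -> p = q.
Proof.
case: p q => [p pU] [q qU] /= pq.
have E : q = p by apply: max_filter pq; exact: ultra_proper.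
by subst q; congr Beta; exact: Prop_irrelevance.
Qed.

Lemma betaC p A : p (~` A) <-> ~ p A.
Proof.
split=> [pnA pA|npA]; last by have [] := in_ultra_setVsetC A (beta_ultra p).
by have /filter_ex [x []] : p (A `&` ~` A) by exact: filterI.
Qed.

Lemma ultraP (F : set_system S) :
  ProperFilter F -> (forall A, F A \/ F (~` A)) -> UltraFilter F.
Proof.
move=> FF Fd; split=> // G GF FG; apply/seteqP; split=> // A GA.
have [//|/FG GnA] := Fd A.
by have /filter_ex [x []] : G (A `&` ~` A) by exact: filterI.
Qed.

Definition beta_clopen A : set (beta S) := [set p : beta S | p A].

Lemma beta_clopen_cover : \bigcup_(A in setT) beta_clopen A = setT.
Proof. by apply/seteqP; split=> // p _; exists setT => //; exact: filterT. Qed.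

Lemma beta_clopen_join A B p : setT A -> setT B ->
  beta_clopen A p -> beta_clopen B p ->
  exists C, [/\ setT C, beta_clopen C p
    & beta_clopen C `<=` beta_clopen A `&` beta_clopen B].
Proof.
move=> _ _ pA pB; exists (A `&` B); split=> //; first exact: filterI.
by move=> q qAB; split; apply: filterS qAB => x [].
Qed.

End BetaFacts.

(* The Stone topology: the sets {p | A \in p} form a base. *)
HB.instance Definition _ S := isBaseTopological.Build (beta S)
  (@beta_clopen_cover S) (@beta_clopen_join S).

Section BetaTopology.
Variable S : Type.
Implicit Types (p q : beta S) (A B : set S).

Lemma open_beta_clopen A : open (beta_clopen A).
Proof. by exists [set A] => //; rewrite bigcup_set1. Qed.

Lemma nbhs_betaP p (U : set (beta S)) :
  nbhs p U <-> exists2 A, p A & beta_clopen A `<=` U.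
Proof.
split=> [|[A pA AU]]; last first.
  apply: filterS AU _; apply: open_nbhs_nbhs; split=> //.
  exact: open_beta_clopen.
rewrite nbhsE => -[V [[D _ <-] [A DA pA]] VU].
by exists A => // q qA; apply: VU; exists A.
Qed.

Lemma beta_hausdorff : hausdorff_space (beta S).
Proof.
move=> p q pq; apply: beta_ext => A pA; apply: contrapT => /betaC qnA.
have [||r [rA /betaC]//] := pq (beta_clopen A) (beta_clopen (~` A)).
- by apply/nbhs_betaP; exists A.
- by apply/nbhs_betaP; exists (~` A).
Qed.

Lemma beta_compact : compact [set: beta S].
Proof.
rewrite compact_ultra => F FU _.
have LF : UltraFilter [set A | F (beta_clopen A)].
  apply: ultraP; last first.
    move=> A; have [|FnA] := in_ultra_setVsetC (beta_clopen A) FU; first by left.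
    by right; apply: filterS FnA => p /betaC.
  split; first by move=> F0; have [p p0] := @filter_ex _ F _ _ F0; have [] := filter_ex p0.
  split.
  - by apply: (@filterS _ F _ setT) => [p _|]; exact: filterT.
  - by move=> A B; apply: (@filterS2 _ F) => p; exact: filterI.
  - by move=> A B AB; apply: (@filterS _ F) => p; exact: filterS.
exists (Beta LF); split=> // U /nbhs_betaP[A FA AU].
exact: filterS AU FA.
Qed.

End BetaTopology.

Local Open Scope group_scope.

Section BetaSemigroup.
Variable S : semigroupType.
Implicit Types p q r : beta S.

Definition beta_mul_sets p q : set_system S :=
  [set A | p [set x | q [set y | A (x * y)]]].

Fact beta_mul_ultra p q : UltraFilter (beta_mul_sets p q).
Proof.
apply: ultraP; last first.
  move=> A.
  have [pA|pnA] := in_ultra_setVsetC [set x | q [set y | A (x * y)]] (beta_ultra p).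
    by left.
  by right; apply: filterS pnA => x /betaC.
split; first by move=> p0; have [x q0] := @filter_ex _ p _ _ p0; have [] := filter_ex q0.
split.
- by apply: (@filterS _ p _ setT) => [x _|]; exact: filterT.
- by move=> A B; apply: (@filterS2 _ p) => x; exact: filterI.
- by move=> A B AB; apply: (@filterS _ p) => x; apply: filterS => y; exact: AB.
Qed.

Definition beta_mul p q : beta S := Beta (beta_mul_ultra p q).

Lemma beta_mulA : associative beta_mul.
Proof.
move=> p q r; apply: beta_ext => A; apply: (@filterS _ p) => x.
apply: (@filterS _ q) => y; apply: (@filterS _ r) => z.
by rewrite /= mulgA.
Qed.

End BetaSemigroup.

HB.instance Definition _ (S : semigroupType) :=
  isSemigroup.Build (beta S) (@beta_mulA S).

Lemma beta_mulE (S : semigroupType) (p q : beta S) (A : set S) :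
  (p * q : beta S) A = p [set x | q [set y | A (x * y)]].
Proof. by []. Qed.

Lemma beta_mul_continuous (S : semigroupType) (q : beta S) :
  continuous (fun p : beta S => p * q).
Proof.
move=> p U /nbhs_betaP[A pqA AU]; apply/nbhs_betaP.
by exists [set x | q [set y | A (x * y)]] => // r rA; exact: AU.
Qed.

Definition two_sided_ideal (T : semigroupType) (I : set T) :=
  I !=set0 /\ forall s x, I x -> I (s * x) /\ I (x * s).

Definition word (A : choiceType) := {s : seq A | s != [::]}.

HB.instance Definition _ (A : choiceType) := Choice.on (word A).

Section Words.
Variable A : choiceType.

Fact word_mul_subproof (u v : word A) : val u ++ val v != [::].
Proof. by case: u => -[]. Qed.

Definition word_mul (u v : word A) : word A :=
  exist _ (val u ++ val v) (word_mul_subproof u v).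

Lemma word_mulA : associative word_mul.
Proof. by move=> u v w; apply: val_inj; rewrite /= catA. Qed.

End Words.

HB.instance Definition _ (A : choiceType) :=
  isSemigroup.Build (word A) (@word_mulA A).

(* In [A + 'I_n], [inl a] is the letter a and [inr i] is the variable v_(i+1). *)
Definition variable_words (A : choiceType) (n : nat) : set (word (A + 'I_n)%type) :=
  [set w | forall i : 'I_n, inr i \in val w].

Section Substitution.
Variables (A : choiceType) (n : nat).

Definition subst_letter (x : n.-tuple A) (c : A + 'I_n) : A :=
  match c with inl a => a | inr i => tnth x i end.

Fact word_subst_subproof (w : word (A + 'I_n)%type) (x : n.-tuple A) :
  map (subst_letter x) (val w) != [::].
Proof. by case: w => -[]. Qed.

Definition word_subst (w : word (A + 'I_n)%type) (x : n.-tuple A) : word A :=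
  exist _ (map (subst_letter x) (val w)) (word_subst_subproof w x).

End Substitution.

Definition Rn (A : choiceType) (n : nat) : set (beta (word A)) :=
  [set p : beta (word A) | forall B : set (word A), p B ->
     exists2 w, variable_words w & [set word_subst w x | x in [set: n.-tuple A]] `<=` B].

Arguments Rn : clear implicits.

(* Main.v *)
(** The only hard point is that [Rn A n] is nonempty, which amounts to the
    multidimensional Hales-Jewett theorem. Let [p] be a minimal idempotent of
    the ultrafilters on words over [A], and let [e] be a minimal idempotent,
    among ultrafilters on words over [A + 'I_n], of the left ideal generated by
    (the image of) [p]. Then [q = p * e] contains the set of words in which every
    variable occurs, because these words form an ideal. Each substitution
    [x] is a homomorphism fixing words over [A], so it maps [q] to an idempotent
    below [p], which is [p] itself by minimality. Hence if [B] belongs to [p],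
    then [q]-almost every word has all its substitution instances in [B]. *)
Require Import Defs.
From mathcomp Require Import all_boot all_classical topology.

Set Implicit Arguments.
Unset Strict Implicit.
Unset Printing Implicit Defensive.

Local Open Scope classical_set_scope.
Local Open Scope group_scope.

(** A chain of nonempty sets is a filter base; a cluster point of its filter lies in every closed
    member. *)
Lemma compact_chain_bigcap (T : topologicalType) (F : set (set T)) :
  compact [set: T] -> F !=set0 -> total_on F subset ->
  (forall C, F C -> closed C /\ C !=set0) -> \bigcap_(C in F) C !=set0.
Proof.
move=> cT F0 Ftot FC.
have FF : Filter (filter_from F id).
  apply: filter_from_filter => // C D FC' FD; case: (Ftot _ _ FC' FD) => sub.
    by exists C => // x Cx; split=> //; exact: sub.
  by exists D => // x Dx; split=> //; exact: sub.
have PF : ProperFilter (filter_from F id).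
  by apply: filter_from_proper => // C /FC[].
have [x [_ clx]] := cT _ PF filterT.
exists x => C FC'; have [cC _] := FC _ FC'; apply: cC => U nU.
by apply: clx => //; exists C.
Qed.

(** Zorn's lemma is applied upwards, to the sets [U] removed from [C]. The property [Q] is kept
    abstract so as to serve both for subsemigroups and for left ideals. *)
Lemma exists_minimal_closed (T : topologicalType) (Q : set (set T)) (C : set T) :
  compact [set: T] ->
  (forall F, F `<=` Q -> Q (\bigcap_(D in F) D)) ->
  Q C -> closed C -> C !=set0 ->
  exists M, [/\ Q M, closed M, M !=set0, M `<=` C &
    forall D, Q D -> closed D -> D !=set0 -> D `<=` M -> M `<=` D].
Proof.
move=> cT Qcap QC cC C0.
pose adm D := [/\ Q D, closed D & D !=set0].
have [F PF Ftot|U [admU Umax]] := @Zorn_bigcup T [set U | adm (C `\` U)].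
  have [->|/set0P F0] := eqVneq F set0.
    by rewrite /adm /= bigcup_set0 setD0.
  pose G := [set C `\` U | U in F].
  have -> : [set U | adm (C `\` U)] (\bigcup_(X in F) X) = adm (\bigcap_(D in G) D).
    congr adm; apply/seteqP; split=> [x [Cx nx] _ [U FU <-]|x Gx].
      by split=> // Ux; apply: nx; exists U.
    split; first by have [U FU] := F0; have [] := Gx _ (imageP _ FU).
    by move=> [U FU Ux]; have [] := Gx _ (imageP _ FU).
  have admG D : G D -> adm D by move=> [U /PF ? <-].
  split.
  - by apply: Qcap => D /admG[].
  - by apply: closed_bigI => D /admG[].
  - apply: compact_chain_bigcap => // [|_ _ [U FU <-] [V FV <-]|D /admG[]//].
      by have [U FU] := F0; exists (C `\` U); exists U.
    by case: (Ftot _ _ FU FV) => sub; [right|left]; exact: setDS.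
case: admU => QM cM M0; exists (C `\` U); split=> // D QD cD D0 DM.
(* If [D] were strictly smaller than [C] minus [U], removing the complement of [D] would strictly
   enlarge [U] and leave exactly [D]. *)
apply: contrapT => nMD; apply: (Umax (~` D)).
  split=> [x Ux /DM[]//|DU]; apply: nMD => x [Cx nUx].
  by apply: contrapT => nDx; apply: nUx; exact: DU.
rewrite /adm /= (_ : C `\` ~` D = D) //.
by apply/seteqP; split=> [x [_ /contrapT]//|x Dx]; split=> //; have [] := DM _ Dx.
Qed.

Section MinimalIdempotents.
Variable S : semigroupType.
Implicit Types (p x y t : beta S) (C : set (beta S)).

Lemma closed_principal_left_ideal C x :
  closed C -> closed [set t * x | t in C].
Proof.
move=> cC; apply: compact_closed; first exact: beta_hausdorff.
apply: continuous_compact; last exact: subclosed_compact (@beta_compact S) _.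
exact/continuous_subspaceT/beta_mul_continuous.
Qed.

Lemma closed_left_annihilator x y : closed [set t | t * x = y].
Proof.
apply: (@preimage_closed _ _ (fun t => t * x) [set y]).
  by move=> t _; exact: beta_mul_continuous.
exact/accessible_closed_set1/hausdorff_accessible/beta_hausdorff.
Qed.

(** The Ellis-Numakura argument: any element [e] of a minimal closed subsemigroup turns out to be
    idempotent. *)
Lemma closed_subsemigroup_idempotent C :
  closed C -> C !=set0 -> (forall x y, C x -> C y -> C (x * y)) ->
  exists2 e, C e & e * e = e.
Proof.
move=> cC C0 CM.
pose Q := [set D | forall x y, D x -> D y -> D (x * y)].
have Qcap F : F `<=` Q -> Q (\bigcap_(D in F) D).
  by move=> FQ x y Fx Fy D FD; apply: (FQ) => //; [exact: Fx|exact: Fy].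
have [M [QM cM [e Me] MC Mmin]] :=
  exists_minimal_closed (@beta_compact S) Qcap CM cC C0.
(* [M * e] is a closed subsemigroup inside [M], hence all of [M]; the resulting [t] makes the next
   subsemigroup nonempty. *)
have [t Mt te] : [set t * e | t in M] e.
  apply: (Mmin) (Me).
  - move=> _ _ [s Ms <-] [t Mt <-]; exists (s * e * t); last by rewrite !mulgA.
    by apply: (QM) => //; exact: QM.
  - exact: closed_principal_left_ideal.
  - by exists (e * e); exists e.
  - by move=> _ [s Ms <-]; exact: QM.
have [_ ee] : (M `&` [set s | s * e = e]) e.
  apply: (Mmin) (Me).
  - move=> s r [Ms se] [Mr re]; split; first exact: QM.
    by rewrite /= -mulgA re.
  - by apply: closedI => //; exact: closed_left_annihilator.
  - by exists t.
  - by move=> s [].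
by exists e => //; exact: MC.
Qed.

(* The last clause says that the left ideal generated by [e] is minimal. *)
Lemma minimal_idempotent p : exists e,
  [/\ exists u, e = u * p, e * e = e & forall x, exists t, t * (x * e) = e].
Proof.
pose Q := [set D : set (beta S) | forall x y, D y -> D (x * y)].
have Qcap F : F `<=` Q -> Q (\bigcap_(D in F) D).
  by move=> FQ x y Fy D FD; apply: (FQ) => //; exact: Fy.
have Qp x : Q [set t * x | t in setT].
  by move=> s _ [t _ <-]; exists (s * t) => //; rewrite mulgA.
have cp x : closed [set t * x | t in setT].
  by apply: closed_principal_left_ideal; exact: closedT.
(* Without a unit, [x] itself may lie outside the set of its left multiples. *)
have p0 x : [set t * x | t in setT] !=set0 by exists (x * x); exists x.
have [M [QM cM M0 MC Mmin]] :=
  exists_minimal_closed (@beta_compact S) Qcap (Qp p) (cp p) (p0 p).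
have [e Me ee] : exists2 e, M e & e * e = e.
  by apply: closed_subsemigroup_idempotent => // x y _; exact: QM.
exists e; split=> // [|x]; first by have [u _ <-] := MC _ Me; exists u.
(* The left multiples of [x * e] form a closed left ideal inside [M], so by minimality it contains
   [e]. *)
have [|t _] := Mmin _ (Qp (x * e)) (cp _) (p0 _) _ _ Me; last by exists t.
by move=> _ [t _ <-]; apply: (QM) => //; exact: QM.
Qed.

End MinimalIdempotents.

Section Images.
Variables S T : Type.
Variable f : S -> T.

Fact beta_map_ultra (p : beta S) : UltraFilter [set B | p (f @^-1` B)].
Proof.
by apply: ultraP => B; exact: in_ultra_setVsetC (f @^-1` B) (beta_ultra p).
Qed.

Definition beta_map (p : beta S) : beta T := Beta (beta_map_ultra p).

End Images.

Lemma beta_map_comp (S T U : Type) (f : S -> T) (g : T -> U) (p : beta S) :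
  beta_map g (beta_map f p) = beta_map (g \o f) p.
Proof. exact: beta_ext. Qed.

Lemma beta_map_id (S : Type) (p : beta S) : beta_map id p = p.
Proof. exact: beta_ext. Qed.

Lemma beta_mapM (S T : semigroupType) (f : S -> T) (p q : beta S) :
  {morph f : x y / x * y} -> beta_map f (p * q) = beta_map f p * beta_map f q.
Proof.
move=> fM; apply: beta_ext => B; apply: (@filterS _ p) => x.
by apply: (@filterS _ q) => y; rewrite /= fM.
Qed.

Definition beta_principal (S : Type) (x : S) : beta S :=
  Beta (principal_filter_ultra x).

Section VariableWords.
Variables (A : finType) (n : nat).
Implicit Types (a : A) (u v : word A) (w : word (A + 'I_n)%type).

Fact constant_word_subproof u : map (@inl A 'I_n) (val u) != [::].
Proof. by case: u => -[]. Qed.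

Definition constant_word u : word (A + 'I_n)%type :=
  exist _ (map inl (val u)) (constant_word_subproof u).

Lemma constant_wordM : {morph constant_word : u v / u * v}.
Proof. by move=> u v; apply: val_inj; rewrite /= map_cat. Qed.

Lemma word_substM (x : n.-tuple A) : {morph (@word_subst A n)^~ x : u v / u * v}.
Proof. by move=> u v; apply: val_inj; rewrite /= map_cat. Qed.

Lemma word_subst_constant u (x : n.-tuple A) : word_subst (constant_word u) x = u.
Proof. by apply: val_inj; rewrite /= -map_comp map_id. Qed.

Lemma variable_wordsMl w w' : variable_words w' -> variable_words (w * w').
Proof. by move=> w'v i; rewrite mem_cat w'v orbT. Qed.

Lemma variable_wordsMr w w' : variable_words w -> variable_words (w * w').
Proof. by move=> wv i; rewrite mem_cat wv. Qed.

Lemma variable_words_nonempty a : exists w, variable_words w.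
Proof.
have ne : inl a :: map (@inr A 'I_n) (enum 'I_n) != [::] by [].
exists (exist (fun s => s != [::]) _ ne : word (A + 'I_n)%type) => i /=.
by rewrite inE map_f ?orbT // mem_enum.
Qed.

Lemma Rn_fixed (p : beta (word A)) (q : beta (word (A + 'I_n)%type)) :
  q (@variable_words A n) ->
  (forall x : n.-tuple A, beta_map ((@word_subst A n)^~ x) q = p) -> Rn A n p.
Proof.
move=> qV qp B pB.
have qB : q [set w | forall x, B (word_subst w x)].
  (* There are finitely many tuples [x], so their conditions hold together [q]-almost everywhere. *)
  by apply: (@filter_forall _ _ _ q) => x; move: pB; rewrite -(qp x).
have [w [Vw Bw]] := filter_ex (filterI qV qB).
by exists w => // _ [x _ <-]; exact: Bw.
Qed.

Lemma Rn_nonempty : (0 < #|A|)%N -> Rn A n !=set0.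
Proof.
case/card_gt0P => a _.
have [w Vw] := variable_words_nonempty a.
have ne : [:: a] != [::] by [].
have [p [_ pp pmin]] := minimal_idempotent (beta_principal (exist (fun s => s != [::]) _ ne : word A)).
pose c := beta_map constant_word p.
have cc : c * c = c by rewrite -beta_mapM ?pp //; exact: constant_wordM.
have [e [[u eu] ee emin]] := minimal_idempotent c.
(* Since [e] is a left multiple of the idempotent [c], it is fixed by [c] on the right; multiplying
   by [c] on the left then gives an idempotent [q] fixed on both sides. *)
have ec : e * c = e by rewrite eu -mulgA cc.
pose q := c * e.
have qq : q * q = q by rewrite /q mulgA -(mulgA c e) ec -mulgA ee.
have cq : c * q = q by rewrite /q mulgA cc.
have qc : q * c = q by rewrite /q -mulgA ec.
exists p; apply: (@Rn_fixed _ q) => [|x].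
  (* Minimality writes [e] as [t * (w * e)], which puts the variable word [w] inside almost every
     word. *)
  rewrite /q; have [t <-] := emin (beta_principal w).
  apply: (@filterE _ c) => s; apply: (@filterE _ t) => t' /=.
  have Ve : e [set y | variable_words (s * (t' * (w * y)))].
    apply: (@filterE _ e) => y; do 2 apply: variable_wordsMl.
    exact: variable_wordsMr.
  exact/principal_filterP.
pose h := beta_map ((@word_subst A n)^~ x).
have hM r s : h (r * s) = h r * h s by apply: beta_mapM; exact: word_substM.
have hc : h c = p.
  rewrite /h beta_map_comp -[RHS]beta_map_id; congr beta_map.
  by apply/funext => v; exact: word_subst_constant.
have hqp : h q * p = h q by rewrite -{1}hc -hM qc.
have phq : p * h q = h q by rewrite -{1}hc -hM cq.
have hqq : h q * h q = h q by rewrite -hM qq.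
(* Now [t * h q = p], whence [h q = p * h q = t * h q * h q = t * h q = p]. *)
rewrite -/(h q); have [t] := pmin (h q); rewrite hqp => tp.
by rewrite -phq -{1}tp -mulgA hqq.
Qed.

Lemma Rn_mull (s p : beta (word A)) : Rn A n p -> Rn A n (s * p).
Proof.
move=> Rp B /(@filter_ex _ s)[u pB]; have [w Vw wB] := Rp _ pB.
exists (constant_word u * w); first exact: variable_wordsMl.
by move=> _ [x _ <-]; rewrite word_substM word_subst_constant; apply: wB; exists x.
Qed.

(** Here [w] is chosen first, and one suffix [v] must suit all its instances; being finitely many,
    they impose conditions that [s] satisfies jointly. *)
Lemma Rn_mulr (s p : beta (word A)) : Rn A n p -> Rn A n (p * s).
Proof.
move=> Rp B pB; have [w Vw wB] := Rp _ pB.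
have /filter_ex[v vB] : s [set v | forall x : n.-tuple A, B (word_subst w x * v)].
  by apply: (@filter_forall _ _ _ s) => x; apply: wB; exists x.
exists (w * constant_word v); first exact: variable_wordsMr.
by move=> _ [x _ <-]; rewrite word_substM word_subst_constant; exact: vB.
Qed.

(** Each [B] is tested separately, and its clopen set is a neighbourhood of [p], so some [q] in
    [Rn A n] also contains [B]. *)
Lemma closed_Rn : closed (Rn A n).
Proof.
move=> p clp B pB.
have [|q [Rq qB]] := clp (beta_clopen B); first by apply/nbhs_betaP; exists B.
exact: Rq.
Qed.

End VariableWords.

Theorem theorem5p4 (A : finType) (hA : (0 < #|A|)%N) (n : nat) :
  compact (Rn A n) /\ two_sided_ideal (Rn A n).
Proof.
split; first by apply: subclosed_compact (@closed_Rn A n) (@beta_compact _) _.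
split; first exact: Rn_nonempty.
by move=> s x Rx; split; [exact: Rn_mull|exact: Rn_mulr].
Qed.
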